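(* Let $G=(U,V,E)$ be a vertex-weighted stochastic graph in which every online vertex has unit patience. If the vertices of $V$ arrive in uniformly random order and $\mathcal{M}$ is the matching returned by GreedyProbe (described in the context) on $G$, then $\mathbb{E}[w(\mathcal{M})]\ge\left(1-\frac{1}{e}\right)\cdot\mathrm{OPT}(G)$.
   Context: A stochastic graph is a bipartite graph $G=(U,V,E)$ ($U$ offline, $V$ online) with edge probabilities $p_e$; each edge is independently active with probability $p_e$. It is vertex-weighted with weights $(w_u)_{u\in U}$ (the weight of edge $(u,v)$ is $w_u$). Unit patience means each online vertex $v$ may probe at most one edge of $\partial(v)$ (its probing constraint $\mathcal{C}_v$ consists of the empty string and the single edges of $\partial(v)$). An offline probing algorithm knows $G$ but not the edge states, adaptively probes edges subject to these constraints, and respects commitment: a probed active edge $(u,v)$ with both endpoints currently unmatched is added to the matching. $\mathrm{OPT}(G)$ (committal benchmark) is the maximum expected weight of a matching built by an offline probing algorithm. In the online setting, online vertices arrive one at a time; on arrival of $v$ the algorithm learns the probabilities of the edges at $v$ (but not their states) and must make its probe at $v$ before the next arrival. GreedyProbe: when $v$ arrives, among edges $(u,v)$ with $u$ currently unmatched, probe one maximizing $w_u\cdot p_{u,v}$ (if any); if it is active, add it to $\mathcal{M}$. *)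

(* Defs.v *)
From mathcomp Require Import classical_sets reals.
From mathcomp Require Import all_boot all_order all_algebra perm.

Set Implicit Arguments.
Unset Strict Implicit.
Unset Printing Implicit Defensive.

Import Order.TTheory GRing.Theory Num.Theory.
Local Open Scope ring_scope.

(* An edge is a pair [e : U * V]: [e.1] is its offline and [e.2] its online
   endpoint.  The values of [prob] outside [edges] are irrelevant. *)
Record stochastic_graph (R : realType) (U V : finType) := StochasticGraph {
  edges : {set U * V};
  prob : U * V -> R;
  prob_bounds : forall e, e \in edges -> 0 <= prob e <= 1 }.

Section Model.
Variables (R : realType) (U V : finType).
Implicit Types (G : stochastic_graph R U V) (w : U -> R).
Implicit Types (A M : {set U * V}) (u : U) (v : V) (e : U * V).

(* The law of the random set [A] of active edges: product Bernoulli. *)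
Definition state_prob G A : R :=
  \prod_(e in edges G) (if e \in A then prob G e else 1 - prob G e).

Definition state_expectation G (f : {set U * V} -> R) : R :=
  \sum_(A : {set U * V} | A \subset edges G) state_prob G A * f A.

Definition weight w M : R := \sum_(e in M) w e.1.

Definition offline_matched M u : bool := [exists v, (u, v) \in M].
Definition online_matched M v : bool := [exists u, (u, v) \in M].

(* The probes made so far, oldest first, each with its observed state. *)
Definition history := seq ((U * V) * bool).

(* Commitment: a probed active edge joins the matching as soon as both of its
   endpoints are free. *)
Definition commit M (x : (U * V) * bool) : {set U * V} :=
  if [&& x.2, ~~ offline_matched M x.1.1 & ~~ online_matched M x.1.2]
  then x.1 |: M else M.

Definition matching_of (h : history) : {set U * V} := foldl commit set0 h.

Definition boundary G v : {set U * V} := [set e in edges G | e.2 == v].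

(* The constraint C_v for unit patience. *)
Definition unit_patience G v (s : seq (U * V)) : bool :=
  (s == [::]) || [exists e in boundary G v, s == [:: e]].

Definition feasible G (s : seq (U * V)) : bool :=
  [forall v, unit_patience G v [seq e <- s | e.2 == v]].

(* A (possibly randomized) offline probing algorithm: given the history, a
   distribution over the next action, [Some e] = probe [e], [None] = stop. *)
Definition strategy := history -> option (U * V) -> R.

Definition valid_strategy G (sigma : strategy) : Prop :=
  forall h : history, feasible G (map fst h) ->
  [/\ forall a, 0 <= sigma h a,
      \sum_a sigma h a = 1
    & forall e, ~~ feasible G (rcons (map fst h) e) -> sigma h (Some e) = 0].

(* Expected final weight, over the internal randomness of [sigma] only, when
   the active edges are [A], from history [h] and with at most [k] more
   probes. *)
Fixpoint run w (sigma : strategy) A (k : nat) (h : history) : R :=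
  if k is k'.+1 then
    \sum_(a : option (U * V)) sigma h a *
      (if a is Some e then run w sigma A k' (rcons h (e, e \in A))
       else weight w (matching_of h))
  else weight w (matching_of h).

(* A feasible sequence has at most [#|V|] probes, so the bound [#|V|] never
   cuts a valid strategy short. *)
Definition strategy_value G w (sigma : strategy) : R :=
  state_expectation G (fun A => run w sigma A #|V| [::]).

Definition strategy_values G w : set R :=
  [set x | exists2 sigma, valid_strategy G sigma & x = strategy_value G w sigma]%classic.

Definition OPT G w : R := sup (strategy_values G w).

(* GreedyProbe.  [prio v] is the fixed tie-breaking order of [v], smaller
   values being preferred among the maximizers of [w u * p_(u, v)]. *)
Definition greedy_candidates G M v : {set U} :=
  [set u | ((u, v) \in edges G) && ~~ offline_matched M u].

Definition greedy_choice G w (prio : V -> U -> nat) M v : option U :=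
  [pick u in greedy_candidates G M v |
    [forall u' in greedy_candidates G M v,
       (w u' * prob G (u', v) < w u * prob G (u, v))
       || (w u' * prob G (u', v) == w u * prob G (u, v))
          && (prio v u <= prio v u')%N]].

Definition greedy_step G w prio A (h : history) v : history :=
  if greedy_choice G w prio (matching_of h) v is Some u
  then rcons h ((u, v), (u, v) \in A) else h.

(* [order] lists the online vertices by arrival. *)
Definition greedy_matching G w prio A (order : seq V) : {set U * V} :=
  matching_of (foldl (greedy_step G w prio A) [::] order).

(* A uniform permutation of [V] applied to a fixed enumeration of [V]. *)
Definition uniform_order_expectation (f : seq V -> R) : R :=
  (#|{perm V}|%:R)^-1 * \sum_(pi : {perm V}) f (map pi (enum V)).

Definition greedy_value G w prio : R :=
  uniform_order_expectation (fun order =>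
    state_expectation G (fun A => weight w (greedy_matching G w prio A order))).

Lemma state_prob_ge0 G A : 0 <= state_prob G A.
Proof.
apply: prodr_ge0 => e /prob_bounds /andP[p0 p1].
by case: ifP => // _; rewrite subr_ge0.
Qed.

(* [OPT] is a genuine supremum ([sup] is 0 on unbounded or empty sets). *)
Lemma strategy_values_has_sup G w :
  (forall u, 0 <= w u) -> has_sup (strategy_values G w).
Proof.
move=> w0; pose sigma0 : strategy := fun _ a => (a == None)%:R.
have val0 : valid_strategy G sigma0.
  move=> h _; split=> [a|| e _]; rewrite /sigma0 ?ler0n //.
  rewrite (bigD1 None) //= big1 ?addr0 // => a /negbTE -> //.
pose B : R := \sum_(e : U * V) w e.1.
have wB M : weight w M <= B.
  rewrite /B (bigID (mem M)) /= lerDl sumr_ge0 //.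
split; first by exists (strategy_value G w sigma0); exists sigma0.
exists (state_expectation G (fun=> B)) => _ [sigma vs ->].
apply: ler_sum => A _; apply: ler_wpM2l; first exact: state_prob_ge0.
have : feasible G (map fst ([::] : history)).
  by apply/forallP => v; rewrite /unit_patience.
elim: #|V| [::] => [|k IHk] h fh //=.
have [s0 s1 sN] := vs h fh.
rewrite -[leRHS]mul1r -s1 mulr_suml; apply: ler_sum => -[e|] _; last exact: ler_wpM2l.
have [fe|nfe] := boolP (feasible G (rcons (map fst h) e)).
  by apply: ler_wpM2l => //; apply: IHk; rewrite map_rcons.
by rewrite sN // !mul0r.
Qed.

End Model.

(* Main.v *)
Require Import Defs.
From mathcomp Require Import all_boot all_order all_algebra perm.
From mathcomp Require Import reals sequences exp ring lra.

(* A randomized primal-dual argument against the linear program that bounds a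
   probing strategy by the probabilities x_e of probing e = (u, v) while u is
   free: sum_v p_uv x_uv <= 1 and sum_u x_uv <= 1.  Its dual constraints read
   beta_v + p_uv alpha_u >= w_u p_uv.  GreedyProbe pays for the dual: a match of
   u by the vertex in position i gives w_u g(i) to v and w_u (1 - g(i)) to u.
   For an edge (u, v), fix the order of the other vertices, in which u is
   matched at position c; then insert v at a uniform position.  If v comes
   before u is matched, u is available to v, whose expected gain is therefore
   at least w_u p_uv; and the insertion of v never delays the matching of u.
   For arrival times in [0, 1] and g(y) = exp(y - 1) this satisfies the dual
   constraints up to the factor 1 - 1/e.  The discrete analogue of g for n
   vertices is obtained by averaging the geometric rule (1 - 1/N)^(N - 1 - i)
   over the embeddings of n positions in N, with an error 1/N that vanishes as
   N tends to infinity. *)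

Set Implicit Arguments.
Unset Strict Implicit.
Unset Printing Implicit Defensive.

Import Order.TTheory GRing.Theory Num.Theory.
Local Open Scope ring_scope.

(** * Expectations over independent edge states *)

Section Bernoulli.
Variables (R : realType) (T : finType) (p : T -> R).
Implicit Types (S A : {set T}) (f : {set T} -> R).

(** [state_expectation] over an arbitrary set [S], so that states can be revealed one edge at a
    time; [S = edges G] gives back the original. *)
Definition bernoulli_expectation S f : R :=
  \sum_(A : {set T} | A \subset S)
    (\prod_(e in S) (if e \in A then p e else 1 - p e)) * f A.

Lemma eq_bernoulli S f1 f2 : (forall A, A \subset S -> f1 A = f2 A) ->
  bernoulli_expectation S f1 = bernoulli_expectation S f2.
Proof. by move=> eq_f; apply: eq_bigr => A AS; rewrite eq_f. Qed.

Lemma bernoulliZ S a f :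
  bernoulli_expectation S (fun A => a * f A) = a * bernoulli_expectation S f.
Proof. by rewrite /bernoulli_expectation mulr_sumr; apply: eq_bigr => A _; rewrite mulrCA. Qed.

Lemma bernoulliD S f1 f2 :
  bernoulli_expectation S (fun A => f1 A + f2 A) =
  bernoulli_expectation S f1 + bernoulli_expectation S f2.
Proof. by rewrite -big_split; apply: eq_bigr => A _; rewrite mulrDr. Qed.

Lemma bernoulli_sum S (I : Type) (r : seq I) (P : pred I) (F : I -> {set T} -> R) :
  bernoulli_expectation S (fun A => \sum_(i <- r | P i) F i A) =
  \sum_(i <- r | P i) bernoulli_expectation S (F i).
Proof.
rewrite [RHS]exchange_big; apply: eq_bigr => A _.
by rewrite mulr_sumr.
Qed.

Lemma bernoulli_split S e f : e \in S ->
  bernoulli_expectation S f =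
  p e * bernoulli_expectation (S :\ e) (fun A => f (e |: A)) +
  (1 - p e) * bernoulli_expectation (S :\ e) f.
Proof.
move=> eS; rewrite /bernoulli_expectation (bigID (fun A => e \in A)) /= !mulr_sumr.
congr (_ + _); last first.
  apply: eq_big => [A|A /andP[_ eA]]; first by rewrite subsetD1.
  by rewrite (big_setD1 e) //= (negPf eA) mulrA.
rewrite (reindex_onto (fun A => e |: A) (fun A => A :\ e)) /=; last first.
  by move=> A /andP[_ eA]; rewrite setD1K.
apply: eq_big => [A|A /andP[_ /eqP AE]].
  rewrite setU11 andbT subUset sub1set eS /= subsetD1; congr (_ && _).
  apply/eqP/idP => [<-|]; first by rewrite setD11.
  by move=> eA; rewrite setU1K.
rewrite (big_setD1 e) //= setU11 mulrA; congr (_ * _ * _).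
by apply: eq_bigr => x; rewrite !inE => /andP[/negPf -> _].
Qed.

Lemma bernoulli_cst S a : bernoulli_expectation S (fun=> a) = a.
Proof.
elim: #|S| {-2}S (erefl #|S|) => {S} [|n IHn] S.
  move/eqP; rewrite cards_eq0 => /eqP ->; rewrite /bernoulli_expectation.
  rewrite (eq_bigl (xpred1 set0)) => [|A]; last by rewrite subset0.
  by rewrite big_pred1_eq big_set0 mul1r.
move=> cardS; have [S0|[e eS]] := set_0Vmem S; first by move: cardS; rewrite S0 cards0.
have cardS' : #|S :\ e| = n by move: cardS; rewrite (cardsD1 e) eS => -[].
by rewrite (bernoulli_split _ eS) IHn // -mulrDl addrC subrK mul1r.
Qed.

Lemma ler_bernoulli S f1 f2 : {in S, forall e, 0 <= p e <= 1} ->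
    (forall A, A \subset S -> f1 A <= f2 A) ->
  bernoulli_expectation S f1 <= bernoulli_expectation S f2.
Proof.
move=> p01 le_f; apply: ler_sum => A AS; apply: ler_wpM2l; last exact: le_f.
apply: prodr_ge0 => e /p01 /andP[p0 p1].
by case: ifP => // _; rewrite subr_ge0.
Qed.

(** Condition on the state of [e]: only the active branch contributes, and [f] does not see [e]. *)
Lemma bernoulli_indep S e f : e \in S -> (forall A, f (e |: A) = f A) ->
  bernoulli_expectation S (fun A => (e \in A)%:R * f A) =
  p e * bernoulli_expectation S f.
Proof.
move=> eS fe; rewrite !(bernoulli_split _ eS).
rewrite (@eq_bernoulli (S :\ e) (fun A => (e \in e |: A)%:R * _) f) => [|A _]; last first.
  by rewrite setU11 mul1r.
rewrite (@eq_bernoulli (S :\ e) (fun A => (e \in A)%:R * f A) (fun=> 0)) => [|A]; last first.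
  by rewrite subsetD1 => /andP[_ /negPf ->]; rewrite mul0r.
rewrite (@eq_bernoulli (S :\ e) (fun A => f (e |: A)) f) // bernoulli_cst.
by ring.
Qed.

End Bernoulli.

(** * Histories and the matchings they produce *)

Section Histories.
Variables (R : realType) (U V : finType) (G : stochastic_graph R U V).
Implicit Types (h : history U V).

Lemma matching_of_rcons h x :
  matching_of (rcons h x) = commit (matching_of h) x.
Proof. by rewrite /matching_of -cats1 foldl_cat. Qed.

Lemma matching_of_probed h v :
  online_matched (matching_of h) v -> v \in [seq x.1.2 | x <- h].
Proof.
elim/last_ind: h => [|h [[u1 v1] b] IHh]; first by case/existsP => u; rewrite inE.
rewrite matching_of_rcons map_rcons mem_rcons inE /commit /=.
case: ifP => _ /existsP[u]; last by move=> uM; rewrite IHh ?orbT //; apply/existsP; exists u.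
rewrite !inE => /orP[/eqP[_ ->]|uM]; first by rewrite eqxx.
by rewrite IHh ?orbT //; apply/existsP; exists u.
Qed.

Lemma feasible_rcons h e : feasible G (rcons (map fst h) e) ->
  e \in edges G /\ e.2 \notin [seq x.1.2 | x <- h].
Proof.
move/forallP/(_ e.2); rewrite /unit_patience filter_rcons eqxx.
case: eqP => [/(congr1 size)|_ /= /existsP[e' /andP[e'b /eqP]]].
  by rewrite size_rcons.
set s := filter _ _ => se; have s0 : s = [::].
  by apply/size0nil; move: (congr1 size se); rewrite size_rcons => -[].
move: se; rewrite s0 => -[ee']; split.
  by move: e'b; rewrite ee' inE => /andP[].
apply/negP => /mapP[x xh e2].
have : x.1 \in s by rewrite mem_filter e2 eqxx map_f.
by rewrite s0.
Qed.

Lemma offline_matchedU1 (M : {set U * V}) u v u' :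
  offline_matched ((u, v) |: M) u' = (u' == u) || offline_matched M u'.
Proof.
apply/existsP/orP => [[v']|[/eqP ->|/existsP[v' uM]]].
- rewrite !inE => /orP[/eqP[-> _]|uM]; first by left.
  by right; apply/existsP; exists v'.
- by exists v; rewrite setU11.
- by exists v'; rewrite inE uM orbT.
Qed.

End Histories.

(** * Weak duality for adaptive strategies *)

Section WeakDuality.
Variables (R : realType) (U V : finType) (G : stochastic_graph R U V) (w : U -> R).
Variables (sigma : strategy R U V) (alpha : U -> R) (beta : V -> R) (lam : R).
Hypothesis sigma_valid : valid_strategy G sigma.
Hypotheses (alpha_ge0 : forall u, 0 <= alpha u) (beta_ge0 : forall v, 0 <= beta v).
Hypothesis dual_feasible : forall e, e \in edges G ->
  lam * (w e.1 * prob G e) <= beta e.2 + prob G e * alpha e.1.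

Let probed (h : history U V) v := v \in [seq x.1.2 | x <- h].

(** Bounds [lam] times the expected final weight from [h]: the weight already won plus the dual
    variables of the vertices not yet used up. *)
Let potential (h : history U V) : R :=
  lam * weight w (matching_of h) + \sum_(v | ~~ probed h v) beta v
    + \sum_(u | ~~ offline_matched (matching_of h) u) alpha u.

Lemma potential_probe h u v (b : bool) : ~~ probed h v ->
  potential (rcons h ((u, v), b)) = potential h - beta v +
    (b && ~~ offline_matched (matching_of h) u)%:R * (lam * w u - alpha u).
Proof.
move=> vh; have vM : ~~ online_matched (matching_of h) v.
  by apply: contra vh => /matching_of_probed.
rewrite /potential matching_of_rcons /commit /= vM andbT.
rewrite [X in _ = _ + X + _ - _ + _](bigD1 v) //=.
set B := \sum_(_ | _) beta _; set B' := \sum_(_ | _) beta _.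
have -> : B = B'.
  apply: eq_bigl => v'; rewrite /probed map_rcons mem_rcons inE negb_or andbC.
  by [].
case: ifP => [/andP[_ uM]|_]; last by rewrite mul0r; ring.
rewrite [X in _ = _ + X - _ + _](bigD1 u) //=.
set a := \sum_(_ | _) alpha _; set a' := \sum_(_ | _) alpha _.
have -> : a = a' by apply: eq_bigl => u'; rewrite offline_matchedU1 negb_or andbC.
rewrite /weight big_setU1 /=; first by ring.
by apply: contra uM => uvM; apply/existsP; exists v.
Qed.

(** Deferred decisions: [S] holds the edges whose states are still random, [B] edges fixed as
    active. A probe of [(u, v)] spends [beta v] and, if it matches [u], trades [alpha u] for
    [lam * w u]; the potential does not grow in expectation. *)
Lemma run_potential k h (S B : {set U * V}) :
    feasible G (map fst h) -> S \subset edges G -> [disjoint S & B] ->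
    (forall e, e \in edges G -> ~~ probed h e.2 -> e \in S) ->
  lam * bernoulli_expectation (prob G) S (fun A => run w sigma (A :|: B) k h)
    <= potential h.
Proof.
elim: k h S B => [|k IHk] h S B fh SE SB Sh.
  rewrite /= bernoulli_cst /potential -addrA lerDl addr_ge0 ?sumr_ge0 //.
have [s0 s1 sN] := sigma_valid fh.
rewrite /= bernoulli_sum -[leRHS]mul1r -s1 mulr_suml mulr_sumr.
apply: ler_sum => -[e|] _; last first.
  rewrite bernoulli_cst mulrCA; apply: ler_wpM2l => //.
  by rewrite /potential -addrA lerDl addr_ge0 ?sumr_ge0.
rewrite bernoulliZ mulrCA.
have [fe|nfe] := boolP (feasible G (rcons (map fst h) e)); last first.
  by rewrite sN // !mul0r.
apply: ler_wpM2l => //.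
have [eE eh] := feasible_rcons fe.
have eS := Sh e eE eh.
have eB : e \notin B by rewrite (disjointFr SB eS).
have /andP[p0 p1] := prob_bounds eE.
have fe' b : feasible G (map fst (rcons h (e, b))) by rewrite map_rcons.
have SE' : S :\ e \subset edges G by apply: subset_trans SE; apply: subsetDl.
have Sh' b e' : e' \in edges G -> ~~ probed (rcons h (e, b)) e'.2 -> e' \in S :\ e.
  move=> e'E; rewrite /probed map_rcons mem_rcons inE negb_or => /andP[ne e'h].
  by rewrite !inE Sh // andbT; apply: contraNneq ne => ->.
have SB1 : [disjoint S :\ e & e |: B].
  rewrite disjoints_subset; apply/subsetP => x; rewrite !inE negb_or => /andP[-> xS] /=.
  by rewrite (disjointFr SB xS).
have SB0 : [disjoint S :\ e & B] by apply: disjointWl SB; apply: subsetDl.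
have H1 := IHk _ _ _ (fe' true) SE' SB1 (Sh' true).
have H0 := IHk _ _ _ (fe' false) SE' SB0 (Sh' false).
rewrite (bernoulli_split _ _ eS).
have -> : bernoulli_expectation (prob G) (S :\ e)
      (fun A => run w sigma (e |: A :|: B) k (rcons h (e, e \in e |: A :|: B))) =
    bernoulli_expectation (prob G) (S :\ e)
      (fun A => run w sigma (A :|: (e |: B)) k (rcons h (e, true))).
  by apply: eq_bernoulli => A _; rewrite -setUA setUCA !inE eqxx orbT.
have -> : bernoulli_expectation (prob G) (S :\ e)
      (fun A => run w sigma (A :|: B) k (rcons h (e, e \in A :|: B))) =
    bernoulli_expectation (prob G) (S :\ e)
      (fun A => run w sigma (A :|: B) k (rcons h (e, false))).
  by apply: eq_bernoulli => A; rewrite subsetD1 !inE (negPf eB) => /andP[_ /negPf ->].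
have d := dual_feasible eE.
move: H1 H0; case: e {fe eS fe' Sh' SE' SB1 SB0} eE eh eB p0 p1 d => u v /= eE eh eB p0 p1 d.
rewrite !potential_probe //= mul0r addr0.
set X := bernoulli_expectation _ _ _; set Y := bernoulli_expectation _ _ _.
move=> H1 H0; have /= bv := beta_ge0 v; have au := alpha_ge0 u.
(* If [u] is free, averaging the two branches leaves exactly the dual constraint [d]; if [u] is
   already matched, [beta v >= 0] suffices. *)
move: H1; case: (~~ _) => /= H1; nra.
Qed.

Lemma weak_duality :
  lam * strategy_value G w sigma <= \sum_v beta v + \sum_u alpha u.
Proof.
have f0 : feasible G (map fst ([::] : history U V)) by apply/forallP.
have := @run_potential #|V| [::] (edges G) set0 f0 (subxx _).
rewrite disjoints_subset setC0 subsetT => /(_ isT) /(_ (fun _ eE _ => eE)).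
rewrite /potential /= /weight big_set0 mulr0 add0r.
rewrite [X in _ <= _ + X -> _](eq_bigl xpredT); last first.
  by move=> u; apply/negP => /existsP[v]; rewrite inE.
by under eq_bernoulli do rewrite setU0.
Qed.

End WeakDuality.

(** * Discrete rules for splitting the weight of a match *)

Section Sharing.
Variable R : realType.

(* When the online vertex in position [i] (counted from 0) of an order of [n]
   vertices is matched to [u], it keeps the fraction [g i] of [w u] and [u] the
   rest.  The last inequality covers an edge [(u, v)]: when [u] is matched at
   position [c] of the order without [v] ([c = n.-1] if it never is), inserting
   [v] at a uniform position [j] gives [v] at least [g j] if [j <= c], and
   leaves [u] matched at position at most [c.+1] if [j <= c], and at most [c]
   otherwise. *)
Definition sharing_rule (kappa : R) (n : nat) (g : nat -> R) : Prop :=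
  [/\ {homo g : i j / (i <= j)%N >-> i <= j},
      forall i, 0 <= g i <= 1,
      forall i, (n <= i)%N -> g i = 1
    & forall c, (c < n)%N ->
        c.+1%:R * g c.+1 + (n - c.+1)%:R * g c - \sum_(j < c.+1) g j
          <= kappa * n%:R].

(* The error [n.+1%:R^-1] is why [sharing_rule_exists] starts from a size much
   larger than the number of online vertices. *)
Lemma sharing_rule_geometric (n : nat) :
  sharing_rule (1 / expR 1 + n.+1%:R^-1) n.+1 (fun i => (1 - n.+1%:R^-1) ^+ (n - i)).
Proof.
set q : R := 1 - _; have n0 : 0 < n.+1%:R :> R by rewrite ltr0n.
have qE : n.+1%:R * q = n.+1%:R - 1 by rewrite mulrBr mulr1 divff ?gt_eqF.
have q01 : 0 <= q <= 1.
  by rewrite subr_ge0 lerBlDr lerDl invr_ge0 invf_le1 // ler0n ler1n.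
have /andP[q0 q1] := q01.
(* The inequality [1 + x <= expR x] at [x = - n.+1%:R^-1], raised to the power [n.+1]. *)
have qn : q ^+ n.+1 <= 1 / expR 1.
  rewrite mul1r -expRN.
  have -> : -1 = n.+1%:R * - n.+1%:R^-1 :> R by rewrite mulrN divff ?gt_eqF.
  rewrite expRM_natl; apply: lerXn2r; rewrite ?nnegrE ?expR_ge0 //.
  exact: expR_ge1Dx.
(* The sum telescopes because [n.+1%:R * (1 - q) = 1]. *)
have sumq c : (c <= n)%N -> \sum_(j < c.+1) q ^+ (n - j) = n.+1%:R * (q ^+ (n - c) - q ^+ n.+1).
  elim: c => [|c IHc] cn.
    by rewrite big_ord1 subn0 exprS mulrBr mulrA qE; ring.
  rewrite big_ord_recr /= IHc; last exact: ltnW.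
  have -> : (n - c = (n - c.+1).+1)%N by rewrite subnSK.
  by rewrite exprS !mulrBr [in n.+1%:R * (q * _)]mulrA qE; ring.
split=> [i j ij|i|i ni|c cn].
- by apply: ler_wiXn2l => //; apply: leq_sub2l.
- by rewrite exprn_ge0 // exprn_ile1.
- by rewrite (_ : n - i = 0)%N ?expr0 //; apply/eqP; rewrite subn_eq0 ltnW.
rewrite sumq // mulrDl mulVf ?gt_eqF // natrB //.
(* The source of the error term: the two powers differ by [q ^+ (n - c.+1) / n.+1%:R], except at
   [c = n], where truncated subtraction makes both exponents 0. *)
have step : c.+1%:R * (q ^+ (n - c.+1) - q ^+ (n - c)) <= 1.
  move: cn; rewrite ltnS leq_eqVlt => /orP[/eqP ->|cn].
    by rewrite subnn (_ : n - n.+1 = 0)%N ?subrr ?mulr0 ?ler01 //; apply/eqP; rewrite subn_eq0.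
  rewrite -(subnSK cn) exprS -[X in X - _]mul1r -mulrBl.
  have -> : 1 - q = n.+1%:R^-1 by rewrite /q; ring.
  rewrite mulrA mulr_ile1 ?divr_ge0 ?exprn_ge0 ?ler0n //; last exact: exprn_ile1.
  by rewrite ler_pdivrMr // mul1r ler_nat ltnW.
have := ler_wpM2l (ltW n0) qn; move: step.
set x := q ^+ _; set y := q ^+ _; set z := q ^+ _ => ? ?; lra.
Qed.

(* A uniform vertex of the [n.+1] is a dummy: position [i] among the [n] others
   is position [i.+1] if the dummy comes before, i.e. with probability
   [i.+1 / n.+1], and position [i] otherwise. *)
Lemma sharing_rule_pred kappa n g : sharing_rule kappa n.+1 g ->
  exists g', sharing_rule kappa n g'.
Proof.
case=> g_homo g01 g1 gP; have n0 : 0 < n.+1%:R :> R by rewrite ltr0n.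
pose h i := if (i < n)%N then (i.+1%:R * g i.+1 + (n - i)%:R * g i) / n.+1%:R else 1.
have hE i : (i <= n)%N -> n.+1%:R * h i = i.+1%:R * g i.+1 + (n - i)%:R * g i.
  rewrite /h leq_eqVlt => /orP[/eqP ->|-> ]; last by rewrite mulrC divfK ?gt_eqF.
  by rewrite ltnn subnn mul0r addr0 g1.
(* As an average of [g i] and [g i.+1], [h i] lies between them; monotonicity and the bounds
   follow. *)
have h_ge i : (i <= n)%N -> g i <= h i <= g i.+1.
  move=> in'; have := g_homo _ _ (leqnSn i); rewrite -subr_ge0; set d := _ - _ => d0.
  have := mulr_ge0 (ler0n R i.+1) d0; have := @mulr_ge0 R (n%:R - i%:R) d.
  rewrite subr_ge0 ler_nat in' d0 => /(_ isT isT); rewrite -natr1 /d => ? ?.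
  by apply/andP; split; rewrite -(ler_pM2l n0) hE // natrB // -!natr1; lra.
have h_out i : (n <= i)%N -> h i = 1 by rewrite /h ltnNge => ->.
have h01 i : 0 <= h i <= 1.
  case: (leqP i n) => [/h_ge/andP[h1 h2]|/ltnW/h_out ->]; last by rewrite ler01 lexx.
  by case/andP: (g01 i) => ? _; case/andP: (g01 i.+1) => _ ?; apply/andP; split; lra.
exists h; split=> // [|c cn].
  apply: homo_leq => // [? ? ?|i]; first exact: le_trans.
  case: (ltnP i n) => [iN|ni]; last by rewrite !h_out // leqW.
  case/andP: (h_ge i (ltnW iN)) => _ /le_trans; apply.
  by case/andP: (h_ge i.+1 iN).
(* [g j] is counted [j] times through [h (j - 1)] and [n - j] times through [h j]; only the last
   term [g k] lacks its second share. *)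
have sumh k : (k <= n)%N -> n.+1%:R * \sum_(j < k) h j = n%:R * \sum_(j < k) g j + k%:R * g k.
  elim: k => [|k IHk] kn; first by rewrite !big_ord0; ring.
  rewrite !big_ord_recr /= mulrDr IHk ?hE; try exact: ltnW.
  by rewrite natrB ?(ltnW kn) // -!natr1; ring.
rewrite -(ler_pM2l n0) mulrBr sumh //.
(* The constraint at [c] combines those of [g] at [c] and [c.+1], with weights [n - c.+1] and
   [c.+1]. *)
have P0 := gP c (ltnW cn); have P1 := gP c.+1 cn.
rewrite !subSS -hE ?(ltnW cn) // in P0.
rewrite !subSS -hE // big_ord_recr /= in P1.
have c0 : 0 <= c.+1%:R :> R by rewrite ler0n.
have nc0 : 0 <= (n - c.+1)%:R :> R by rewrite ler0n.
have nE : n%:R = (n - c.+1)%:R + c.+1%:R :> R by rewrite -natrD subnK.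
have := ler_wpM2l c0 P1; have := ler_wpM2l nc0 P0.
set s := \sum_(j < _) _; rewrite -natr1 nE in n0 *.
set a := (n - c.+1)%:R in n0 *; set b := c.+1%:R in n0 *.
move=> ? ?; nra.
Qed.

(** Dummies are discarded one at a time from size [N.+1] down to [n]. This preserves [kappa], so the
    error depends on [N] alone. *)
Lemma sharing_rule_exists n N : (n <= N.+1)%N ->
  exists g, sharing_rule (1 / expR 1 + N.+1%:R^-1) n g.
Proof.
move=> nN; rewrite -(subKn nN); elim: (N.+1 - n)%N => [|k [g gP]].
  by rewrite subn0; eexists; apply: sharing_rule_geometric.
case: (leqP N.+1 k) => [Nk|kN].
  (* Truncated subtraction: both sizes are 0 here. *)
  exists g; rewrite (eqP (leqW Nk : N.+1 - k.+1 == 0)%N).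
  by rewrite (eqP (Nk : N.+1 - k == 0)%N) in gP.
by apply: (@sharing_rule_pred _ _ g); rewrite subnSK.
Qed.

End Sharing.

(** * Uniform orders as uniform insertions *)

Section Orders.
Variables (R : realType) (V : finType).

Definition insert_at (j : nat) (v : V) (t : seq V) := take j t ++ v :: drop j t.

Lemma perm_insert_at j v t : perm_eq (insert_at j v t) (v :: t).
Proof. by rewrite /insert_at perm_catC /= perm_cons perm_catC cat_take_drop. Qed.

Lemma index_insert_at j v t : (j <= size t)%N -> v \notin t ->
  index v (insert_at j v t) = j.
Proof.
move=> jt vt; rewrite index_cat /= eqxx addn0 size_takel //.
by rewrite (negPf (contra (@mem_take j _ t v) vt)).
Qed.

Lemma rem_insert_at j v t : v \notin t -> rem v (insert_at j v t) = t.
Proof.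
move=> vt; rewrite /insert_at.
elim: t j vt => [|x t IHt] [|j] /=; rewrite ?eqxx // inE negb_or eq_sym => /andP[/negPf -> vt].
by rewrite IHt.
Qed.

Lemma insert_at_rem v (s : seq V) : v \in s -> insert_at (index v s) v (rem v s) = s.
Proof.
rewrite /insert_at; elim: s => //= x s IHs; rewrite inE [v == x]eq_sym.
by case: eqVneq => [-> |_ /= vs] //=; rewrite ?take0 ?drop0 // IHs.
Qed.

Lemma sum_orders (f : seq V -> R) :
  uniform_order_expectation f =
  (#|V|`!%:R)^-1 * \sum_(s <- permutations (enum V)) f s.
Proof.
have card_perms : #|{perm V}| = #|V|`!.
  rewrite -[in RHS]cardsT -card_perm; apply: eq_card => pi.
  by rewrite !inE; symmetry; apply/subsetP => x; rewrite inE.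
rewrite /uniform_order_expectation card_perms; congr (_ * _).
rewrite -(big_map (fun pi : {perm V} => map pi (enum V)) xpredT f).
apply: perm_big; set s1 := map _ _.
have s1_uniq : uniq s1.
  rewrite map_inj_uniq ?index_enum_uniq // => pi1 pi2 eq_pi.
  by apply/permP => x; move/eq_in_map: eq_pi; apply; rewrite mem_enum.
have sub : {subset s1 <= permutations (enum V)}.
  move=> _ /mapP[pi _ ->]; rewrite mem_permutations; apply: uniq_perm.
  - by rewrite map_inj_uniq ?enum_uniq //; apply: perm_inj.
  - exact: enum_uniq.
  - move=> x; rewrite mem_enum; apply/mapP; exists (pi^-1 x)%g; rewrite ?mem_enum //.
    by rewrite permKV.
apply: uniq_perm => //; first exact: permutations_uniq.
apply: (uniq_min_size s1_uniq sub _).2.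
rewrite size_permutations ?enum_uniq // -cardE -card_perms size_map cardE.
by rewrite enumT [index_enum _]unlock.

Qed.

(** Inserting [v] at [j] into [t] is a bijection onto the orders, with inverse given by [rem v] and
    [index v]. *)
Lemma uniform_order_insert v (f : seq V -> R) :
  uniform_order_expectation f =
  (#|V|`!%:R)^-1 * \sum_(t <- permutations (rem v (enum V)))
                     \sum_(j < #|V|) f (insert_at j v t).
Proof.
rewrite sum_orders; congr (_ * _).
have notin t : t \in permutations (rem v (enum V)) -> v \notin t.
  rewrite mem_permutations => /perm_mem ->; by rewrite mem_rem_uniqF ?enum_uniq.
have size_rest t j : t \in permutations (rem v (enum V)) ->
    j \in index_iota 0 #|V| -> (j <= size t)%N.
  rewrite mem_permutations mem_iota add0n subn0 => /perm_size -> /=.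
  rewrite size_rem ?mem_enum // -cardE.
  by case: #|V|.
under [RHS]eq_bigr do rewrite -(big_mkord xpredT (fun j => f (insert_at j v _))).
rewrite -(big_allpairs_dep (h := fun t j => insert_at j v t) (F := f)).
apply: perm_big; apply: uniq_perm; first exact: permutations_uniq.
  apply: allpairs_uniq; [exact: permutations_uniq|exact: iota_uniq|].
  move=> _ _ /allpairsP[[t j] /= [tP jP ->]] /allpairsP[[t' j'] /= [tP' jP' ->]] eq_ins.
  have eq_t : t = t' by rewrite -(rem_insert_at j (notin t tP)) eq_ins rem_insert_at ?notin.
  have /= := congr1 (index v) eq_ins.
  by rewrite !index_insert_at ?notin ?size_rest // eq_t => ->.
move=> s; rewrite mem_permutations; apply/idP/allpairsP => [sP|[[t j] /= [tP jP ->]]].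
  have vs : v \in s by rewrite (perm_mem sP) mem_enum.
  exists (rem v s, index v s); split=> /=; last by rewrite insert_at_rem.
    rewrite mem_permutations -(perm_cons v) perm_sym.
    have vE : v \in enum V by rewrite mem_enum.
    apply: perm_trans (perm_to_rem vs); rewrite perm_sym.
    exact: perm_trans sP (perm_to_rem vE).
  by rewrite mem_iota /= add0n subn0 cardE -(perm_size sP) index_mem.
rewrite (perm_trans (perm_insert_at _ _ _)) // perm_sym.
rewrite (perm_trans (perm_to_rem (mem_enum _ v))) // perm_cons perm_sym.
by rewrite -mem_permutations.
Qed.

End Orders.

(** * Behaviour of GreedyProbe and the shares it pays *)

Section Greedy.
Variables (R : realType) (U V : finType) (G : stochastic_graph R U V) (w : U -> R).
Variable prio : V -> U -> nat.
Hypothesis w_ge0 : forall u, 0 <= w u.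
Hypothesis prio_inj : forall v, injective (prio v).
Implicit Types (A M : {set U * V}) (s t : seq V) (u : U) (v : V).

Local Notation choice := (greedy_choice G w prio).
Local Notation greedy := (greedy_matching G w prio).

Let dominated v u u' : bool :=
  (w u' * prob G (u', v) < w u * prob G (u, v))
  || (w u' * prob G (u', v) == w u * prob G (u, v)) && (prio v u <= prio v u')%N.

(** Injectivity of [prio v] leaves at most one maximizer, so [pick] is determined. A choice thus
    survives any shrinking of the candidate set that retains it. *)
Lemma greedy_choiceP M v u : choice M v = Some u <->
  u \in greedy_candidates G M v /\
  forall u', u' \in greedy_candidates G M v -> dominated v u u'.
Proof.
rewrite /greedy_choice; case: pickP => [a /andP[aC /forall_inP amax]|none].
  split=> [[<-]|[uC umax]] //; congr Some; apply: (@prio_inj v).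
  have := amax _ uC; have := umax _ aC; rewrite /dominated.
  case: ltgtP => //= _ le1 le2; by apply/eqP; rewrite eqn_leq le1 le2.
split=> // -[uC umax]; move: (none u); rewrite uC /=.
by move/negbT/negP; case; apply/forall_inP.
Qed.

Lemma greedy_choice_exists M v u : u \in greedy_candidates G M v ->
  exists2 a, choice M v = Some a & w u * prob G (u, v) <= w a * prob G (a, v).
Proof.
move=> uC; set C := greedy_candidates G M v; pose score a := w a * prob G (a, v).
pose b := [arg max_(a > u in C) score a]%O.
have [bC bmax] : b \in C /\ forall a, a \in C -> score a <= score b.
  by rewrite /b; case: arg_maxP.
have bP : (b \in C) && (score b == score b) by rewrite bC eqxx.
pose c := [arg min_(a < b | (a \in C) && (score a == score b)) prio v a].
have [/andP[cC /eqP cb] cmin] : (c \in C) && (score c == score b) /\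
    forall a, (a \in C) && (score a == score b) -> (prio v c <= prio v a)%N.
  by rewrite /c; case: arg_minnP.
exists c; last by rewrite -/(score _) -/(score c) cb bmax.
apply/greedy_choiceP; split=> // a aC; rewrite /dominated -!/(score _) cb.
have := bmax a aC; rewrite le_eqVlt => /orP[ab|->] //.
by rewrite cmin ?aC // ab orbT.
Qed.

Lemma greedy_choice_candidate M v u : choice M v = Some u ->
  (u, v) \in edges G /\ ~~ offline_matched M u.
Proof. by move/greedy_choiceP => -[]; rewrite inE => /andP. Qed.

Lemma offline_matchedS M M' u : M \subset M' -> offline_matched M u -> offline_matched M' u.
Proof. by move=> MM' /existsP[v uM]; apply/existsP; exists v; apply: (subsetP MM'). Qed.

Lemma greedy_rcons A s v : greedy A (rcons s v) =
  if choice (greedy A s) v is Some u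
  then commit (greedy A s) ((u, v), (u, v) \in A) else greedy A s.
Proof.
rewrite /greedy_matching -cats1 foldl_cat /= /greedy_step.
by case: (choice _ v) => [u|] //; rewrite matching_of_rcons.
Qed.

Lemma greedy_subset_rcons A s v : greedy A s \subset greedy A (rcons s v).
Proof.
rewrite greedy_rcons; case: (choice _ v) => [u|] //.
by rewrite /commit; case: ifP => // _; apply: subsetUr.
Qed.

Lemma greedy_subset_cat A s t : greedy A s \subset greedy A (s ++ t).
Proof.
elim/last_ind: t => [|t x IHt]; first by rewrite cats0.
by rewrite -rcons_cat; apply: subset_trans IHt (greedy_subset_rcons _ _ _).
Qed.

Lemma greedy_mem A s u v : (u, v) \in greedy A s -> v \in s.
Proof.
elim/last_ind: s => [|s x IHs]; first by rewrite inE.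
rewrite greedy_rcons mem_rcons inE; case: (choice _ x) => [a|].
  rewrite /commit; case: ifP => _; last by move/IHs => ->; rewrite orbT.
  by rewrite !inE => /orP[/eqP[_ ->]|/IHs ->]; rewrite ?eqxx ?orbT.
by move/IHs => ->; rewrite orbT.
Qed.

Lemma greedy_online_fresh A s v : v \notin s -> ~~ online_matched (greedy A s) v.
Proof. by apply: contra => /existsP[u /greedy_mem]. Qed.

Lemma mem_greedy_rcons A s u v : v \notin s ->
  ((u, v) \in greedy A (rcons s v)) =
  (choice (greedy A s) v == Some u) && ((u, v) \in A).
Proof.
move=> vs; have uvN : ((u, v) \in greedy A s) = false.
  by apply/negP => /greedy_mem; apply/negP.
rewrite greedy_rcons; case cE: (choice _ v) => [a|]; last by rewrite uvN.
have [_ aM] := greedy_choice_candidate cE.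
rewrite /commit /= aM (greedy_online_fresh A vs) !andbT.
have -> : (Some a == Some u) = (a == u) by [].
case: (eqVneq a u) => [->|au] /=; last first.
  case: ifP => _; rewrite ?inE uvN // orbF; apply/negP => /eqP[/esym/eqP].
  by rewrite (negPf au).
by case: ifP => _; rewrite ?setU11 ?uvN.
Qed.

(* By induction the run with [v] leaves fewer candidates to each later vertex;
   if one of them is the choice of the run without [v], it stays the choice. *)
Lemma greedy_offline_monotone A t1 t2 v u : uniq (t1 ++ v :: t2) ->
  offline_matched (greedy A (t1 ++ t2)) u ->
  offline_matched (greedy A (t1 ++ v :: t2)) u.
Proof.
elim/last_ind: t2 u => [|t2 x IHt] u.
  by move=> _; rewrite cats0; apply/offline_matchedS/greedy_subset_cat.
rewrite -rcons_cons -!rcons_cat rcons_uniq => /andP[xs us] /existsP[y].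
have xt : x \notin t1 ++ t2.
  by move: xs; rewrite !mem_cat inE !negb_or => /and3P[-> _ ->].
have [yx|yx] := eqVneq y x; last first.
  move=> uy; apply: (offline_matchedS (greedy_subset_rcons _ _ _)); apply: IHt => //.
  apply/existsP; exists y; move: uy; rewrite greedy_rcons.
  case: (choice _ x) => [a|] //; rewrite /commit; case: ifP => // _.
  by rewrite !inE => /orP[/eqP[_ /eqP]|//]; rewrite (negPf yx).
rewrite yx mem_greedy_rcons // => /andP[/eqP cE uA].
have [um|um] := boolP (offline_matched (greedy A (t1 ++ v :: t2)) u).
  exact: (offline_matchedS (greedy_subset_rcons _ _ _)).
apply/existsP; exists x; rewrite mem_greedy_rcons // uA andbT.
apply/eqP/greedy_choiceP.
have [_ umax] := (greedy_choiceP _ _ _).1 cE.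
have [uE _] := greedy_choice_candidate cE.
split=> [|a]; first by rewrite inE uE.
rewrite inE => /andP[aE am]; apply: umax; rewrite inE aE /=.
by apply: contra am; apply: IHt.
Qed.

(** The state of an edge is read only when its online endpoint arrives. *)
Lemma greedy_indep A s u v : v \notin s -> greedy ((u, v) |: A) s = greedy A s.
Proof.
elim/last_ind: s => [|s x IHs] //.
rewrite mem_rcons inE negb_or => /andP[vx vs].
rewrite !greedy_rcons IHs //; case: (choice _ x) => [a|] //.
rewrite !inE; case: eqP => // -[_ /esym/eqP]; by rewrite (negPf vx).
Qed.

Section Shares.
Variable g : nat -> R.
Hypotheses (g_homo : {homo g : i j / (i <= j)%N >-> i <= j}).
Hypothesis g01 : forall i, 0 <= g i <= 1.

Definition offline_share s A u : R :=
  \sum_v ((u, v) \in greedy A s)%:R * (w u * (1 - g (index v s))).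
Definition online_share s A v : R :=
  \sum_u ((u, v) \in greedy A s)%:R * (w u * g (index v s)).

Lemma sum_shares s A :
  \sum_v online_share s A v + \sum_u offline_share s A u = weight w (greedy A s).
Proof.
rewrite exchange_big -big_split /= /weight [RHS]big_mkcond.
rewrite [RHS](eq_bigr (fun e => if (e.1, e.2) \in greedy A s then w e.1 else 0)); last first.
  by case.
rewrite -(pair_bigA _ (fun u v => if (u, v) \in greedy A s then w u else 0)) /=.
apply: eq_bigr => u _; rewrite -big_split; apply: eq_bigr => v _ /=.
by case: ifP => _; rewrite ?mul0r ?mul1r; ring.
Qed.

Lemma offline_share_ge0 s A u : 0 <= offline_share s A u.
Proof.
apply: sumr_ge0 => v _; rewrite !mulr_ge0 ?ler0n // subr_ge0.
by case/andP: (g01 (index v s)).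
Qed.

Lemma online_share_ge0 s A v : 0 <= online_share s A v.
Proof.
apply: sumr_ge0 => u _; rewrite !mulr_ge0 ?ler0n //.
by case/andP: (g01 (index v s)).
Qed.

Lemma offline_share_ge k s A u : uniq s -> offline_matched (greedy A (take k.+1 s)) u ->
  w u * (1 - g k) <= offline_share s A u.
Proof.
move=> us /existsP[v uv]; rewrite /offline_share (bigD1 v) //=.
have vk := greedy_mem uv.
have -> : (u, v) \in greedy A s.
  by apply: (subsetP _ _ uv); rewrite -{2}(cat_take_drop k.+1 s) greedy_subset_cat.
rewrite mul1r -[leLHS]addr0 lerD //; last first.
  apply: sumr_ge0 => x _; rewrite !mulr_ge0 ?ler0n // subr_ge0.
  by case/andP: (g01 (index x s)).
rewrite ler_wpM2l // lerD2l lerN2 g_homo //.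
rewrite -ltnS; apply: leq_trans (_ : index v s < size (take k.+1 s))%N _.
  rewrite -{1}(cat_take_drop k.+1 s) index_cat vk.
  by rewrite index_mem.
by rewrite size_take; case: ltnP.
Qed.

(* The value is [size t] if [u] is never matched. *)
Definition match_time t A u : nat :=
  find (fun i => offline_matched (greedy A (take i.+1 t)) u) (iota 0 (size t)).

Lemma match_time_le t A u : (match_time t A u <= size t)%N.
Proof. by rewrite -[leqRHS](size_iota 0); apply: find_size. Qed.

Lemma match_time_matched t A u : (match_time t A u < size t)%N ->
  offline_matched (greedy A (take (match_time t A u).+1 t)) u.
Proof.
move=> lt_t; have := lt_t; rewrite -{1}[size t](size_iota 0) -has_find.
by move/(nth_find 0%N); rewrite -/(match_time t A u) nth_iota.
Qed.

Lemma match_time_unmatched t A u j : (j <= match_time t A u)%N ->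
  ~~ offline_matched (greedy A (take j t)) u.
Proof.
case: j => [_|j jt].
  by rewrite take0; apply/negP => /existsP[v]; rewrite inE.
have := before_find 0%N jt; rewrite nth_iota; last exact: leq_trans jt (match_time_le _ _ _).
by move=> ->.
Qed.

(** When [u] is matched at [c] without [v]: if [j <= c], the first [c.+2] arrivals are the old first
    [c.+1] with [v] inserted, and [greedy_offline_monotone] applies; otherwise the first [c.+1]
    arrivals are unchanged. *)
Lemma offline_share_insert t A u v j (c := match_time t A u) :
    (forall i, (size t < i)%N -> g i = 1) ->
    uniq (v :: t) -> (j <= size t)%N ->
  w u * (1 - g (if (j <= c)%N then c.+1 else c)) <= offline_share (insert_at j v t) A u.
Proof.
move=> g1 uvt jt; have us : uniq (insert_at j v t) by rewrite (perm_uniq (perm_insert_at _ _ _)).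
have [ct|tc] := ltnP c (size t); last first.
  (* Here [u] is never matched in [t]. If [c = size t], then [g c.+1 = 1] and the claimed share is
     0. *)
  have cE : c = size t by apply/eqP; rewrite eqn_leq match_time_le.
  by rewrite cE jt g1 // subrr mulr0 offline_share_ge0.
have cm := match_time_matched ct.
apply: offline_share_ge => //.
case: (leqP j c) => [jc|cj].
  have -> : take c.+2 (insert_at j v t) = take j (take c.+1 t) ++ v :: drop j (take c.+1 t).
    rewrite /insert_at take_cat size_takel // ltnNge (leq_trans jc) ?leqW //=.
    rewrite take_takel ?leqW // subSn ?leqW //=; congr (_ ++ _ :: _).
    by rewrite take_drop subnK // leqW.
  apply: greedy_offline_monotone; last by rewrite cat_take_drop.
  rewrite -/(insert_at _ _ _) (perm_uniq (perm_insert_at _ _ _)).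
  move: uvt => /= /andP[vt ut]; rewrite take_uniq // andbT.
  by apply: contra vt; apply: mem_take.
rewrite /insert_at take_cat size_takel //.
case: ltnP => [cj'|jc']; first by rewrite take_takel // ltnW.
have -> : j = c.+1 by apply/eqP; rewrite eqn_leq jc' cj.
by rewrite subnn take0 cats0.
Qed.

(* The choice made at [v] does not depend on the states of the edges at [v]. *)
Lemma online_share_insert t u v j : (u, v) \in edges G -> uniq (v :: t) -> (j <= size t)%N ->
  bernoulli_expectation (prob G) (edges G)
    (fun A => (j <= match_time t A u)%:R * (w u * prob G (u, v) * g j))
  <= bernoulli_expectation (prob G) (edges G)
       (fun A => online_share (insert_at j v t) A v).
Proof.
move=> uvE /andP[vt ut] jt.
have vj : v \notin take j t by apply: contra vt; apply: mem_take.
pose sel A a : R := (choice (greedy A (take j t)) v == Some a)%:R.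
have /andP[g0 _] := g01 j.
(* Intermediate value: [a] is chosen at position [j] and its edge is active. Such a match persists
   through the later arrivals. *)
apply: (@le_trans _ _ (bernoulli_expectation (prob G) (edges G)
    (fun A => \sum_a ((a, v) \in A)%:R * (sel A a * (w a * g j))))); last first.
  apply: ler_bernoulli => [e|A _]; first exact: prob_bounds.
  apply: ler_sum => a _; rewrite mulrA index_insert_at //.
  rewrite ler_wpM2r ?mulr_ge0 // -natrM mulnb andbC -mem_greedy_rcons // ler_nat.
  case: (boolP (_ \in _)) => //= /(subsetP (greedy_subset_cat A _ (drop j t))).
  by rewrite cat_rcons => ->.
have selE a A : (a, v) \notin edges G -> sel A a = 0.
  by rewrite /sel; case: eqP => // /greedy_choice_candidate[->].
rewrite bernoulli_sum.
rewrite (eq_bigr (fun a => bernoulli_expectation (prob G) (edges G)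
    (fun A => sel A a * (w a * prob G (a, v) * g j)))) => [|a _]; last first.
  have [aE|aN] := boolP ((a, v) \in edges G).
    rewrite bernoulli_indep // => [|A]; last by rewrite /sel greedy_indep.
    by rewrite -bernoulliZ; apply: eq_bernoulli => A _; ring.
  by apply: eq_bernoulli => A _; rewrite selE //; ring.
rewrite -bernoulli_sum; apply: ler_bernoulli => [e|A _]; first exact: prob_bounds.
have sum_ge0 (P : pred U) : 0 <= \sum_(a | P a) sel A a * (w a * prob G (a, v) * g j).
  apply: sumr_ge0 => a _; have [aE|aN] := boolP ((a, v) \in edges G); last first.
    by rewrite selE // mul0r.
  by have /andP[p0 _] := prob_bounds aE; rewrite !mulr_ge0 ?ler0n.
case: leqP => [jc|_]; last by rewrite mul0r.
(* Up to its match time [u] is a candidate for [v], so the choice scores at least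
   [w u * prob G (u, v)]. *)
have [|a aE le_a] := @greedy_choice_exists (greedy A (take j t)) v u.
  by rewrite inE uvE match_time_unmatched.
have sel1 : sel A a = 1 by rewrite /sel aE eqxx.
rewrite (bigD1 a) //= sel1 !mul1r -[leLHS]addr0; apply: lerD; first exact: ler_wpM2r.
exact: sum_ge0.
Qed.

End Shares.
End Greedy.

(** * Expected dual variables and their feasibility *)

Lemma uniform_order_sum (R : realType) (V I : finType) (F : I -> seq V -> R) :
  uniform_order_expectation (fun s => \sum_i F i s) =
  \sum_i uniform_order_expectation (F i).
Proof. by rewrite /uniform_order_expectation -mulr_sumr [in RHS]exchange_big. Qed.

Lemma uniform_order_ge0 (R : realType) (V : finType) (f : seq V -> R) :
  (forall s, 0 <= f s) -> 0 <= uniform_order_expectation f.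
Proof. by move=> f0; rewrite mulr_ge0 ?invr_ge0 ?ler0n ?sumr_ge0. Qed.

Section Duality.
Variables (R : realType) (U V : finType) (G : stochastic_graph R U V) (w : U -> R).
Variable prio : V -> U -> nat.
Hypothesis w_ge0 : forall u, 0 <= w u.
Hypothesis prio_inj : forall v, injective (prio v).
Variables (kappa : R) (g : nat -> R).
Hypothesis g_sharing : sharing_rule kappa #|V| g.

Local Notation expect := (bernoulli_expectation (prob G) (edges G)).

Definition offline_dual u : R :=
  uniform_order_expectation (fun s => expect (fun A => offline_share G w prio g s A u)).
Definition online_dual v : R :=
  uniform_order_expectation (fun s => expect (fun A => online_share G w prio g s A v)).

Lemma sum_duals : \sum_v online_dual v + \sum_u offline_dual u = greedy_value G w prio.
Proof.
rewrite /online_dual /offline_dual -!uniform_order_sum /uniform_order_expectation.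
rewrite -mulrDr -big_split /=; congr (_ * _); apply: eq_bigr => pi _.
rewrite -!bernoulli_sum -bernoulliD; apply: eq_bernoulli => A _.
exact: sum_shares.
Qed.

Lemma offline_dual_ge0 u : 0 <= offline_dual u.
Proof.
case: g_sharing => _ g01 _ _; apply: uniform_order_ge0 => s.
rewrite -[0](bernoulli_cst (prob G) (edges G)).
apply: ler_bernoulli => [e|A _]; first exact: prob_bounds.
exact: offline_share_ge0.
Qed.

Lemma online_dual_ge0 v : 0 <= online_dual v.
Proof.
case: g_sharing => _ g01 _ _; apply: uniform_order_ge0 => s.
rewrite -[0](bernoulli_cst (prob G) (edges G)).
apply: ler_bernoulli => [e|A _]; first exact: prob_bounds.
exact: online_share_ge0.
Qed.

Lemma sum_insertions (n c : nat) (a b : R) : (c < n)%N ->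
  \sum_(j < n) (1 - (if (j <= c)%N then a else b)) =
  n%:R - (c.+1%:R * a + (n - c.+1)%:R * b).
Proof.
move=> cn; rewrite big_split /= sumr_const card_ord sumrN; congr (_ - _).
rewrite -(big_mkord xpredT (fun j => if (j <= c)%N then a else b)).
rewrite (big_cat_nat (n := c.+1)) //=; congr (_ + _).
  rewrite big_mkord (eq_bigr (fun=> a)) => [|j _]; last by rewrite -ltnS ltn_ord.
  by rewrite sumr_const card_ord mulr_natl.
rewrite (eq_big_nat _ _ (F2 := fun=> b)) => [|j /andP[cj _]]; last by rewrite leqNgt cj.
by rewrite sumr_const_nat mulr_natl.
Qed.

Lemma sum_prefix (n c : nat) (f : nat -> R) : (c < n)%N ->
  \sum_(j < n) (j <= c)%:R * f j = \sum_(j < c.+1) f j.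
Proof.
move=> cn; rewrite -(big_mkord xpredT (fun j => (j <= c)%:R * f j)).
rewrite (big_cat_nat (n := c.+1)) //= [X in _ + X]big_nat.
rewrite [X in _ + X]big1 ?addr0 => [|j /andP[cj _]].
  by rewrite big_mkord; apply: eq_bigr => j _; rewrite -ltnS ltn_ord mul1r.
by rewrite leqNgt cj mul0r.
Qed.

(** For each order of the other vertices, sum over the insertion position of the online endpoint;
    the last clause of [sharing_rule], taken at the match time, bounds the total. *)
Lemma duals_feasible e : e \in edges G ->
  (1 - kappa) * (w e.1 * prob G e) <= online_dual e.2 + prob G e * offline_dual e.1.
Proof.
case: e => u v /= uvE; have /andP[p0 p1] := prob_bounds uvE.
case: g_sharing => g_homo g01 g1 gP.
set p := prob G (u, v) in p0 p1 *; set n := #|V|.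
have wp0 : 0 <= w u * p by rewrite mulr_ge0.
have n_gt0 : (0 < n)%N by apply/card_gt0P; exists v.
rewrite /online_dual /offline_dual !(uniform_order_insert v) -/n.
rewrite [X in _ <= _ + X]mulrCA -mulrDr mulr_sumr -big_split /=.
have fact_gt0 : 0 < n`!%:R :> R by rewrite ltr0n fact_gt0.
rewrite -(ler_pM2l fact_gt0) mulVKf ?gt_eqF //.
set Q := permutations _.
have sizeQ : size Q = n.-1`!.
  rewrite size_permutations ?rem_uniq ?enum_uniq // size_rem ?mem_enum //.
  by rewrite -cardE.
(* The left side is spread evenly over the (n - 1)! orders in [Q], each with [n] insertion
   positions. *)
have -> : n`!%:R * ((1 - kappa) * (w u * p)) = \sum_(t <- Q) (w u * p * (n%:R - kappa * n%:R)).
  rewrite big_const_seq count_predT iter_addr_0 sizeQ -[in n`!](prednK n_gt0).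
  by rewrite factS prednK // natrM -mulr_natl; ring.
rewrite [leLHS]big_seq [leRHS]big_seq; apply: ler_sum => t; rewrite mem_permutations => tQ.
have size_t : size t = n.-1 by rewrite (perm_size tQ) size_rem ?mem_enum // -cardE.
have uvt : uniq (v :: t).
  by rewrite /= (perm_mem tQ) mem_rem_uniqF ?enum_uniq // (perm_uniq tQ) rem_uniq ?enum_uniq.
have jt (j : 'I_n) : (j <= size t)%N by rewrite size_t -ltnS prednK.
have g1' i : (size t < i)%N -> g i = 1 by rewrite size_t -ltnS prednK // ltnS => /g1.
pose c A := match_time G w prio t A u.
have cn A : (c A < n)%N.
  by rewrite /c -(prednK n_gt0) ltnS -size_t match_time_le.
rewrite -[leLHS](bernoulli_cst (prob G) (edges G)).
(* Both shares are replaced by their lower bounds in terms of the match time [c A]; what remains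
   holds for each [A] separately. *)
apply: (@le_trans _ _ (
    \sum_(j < n) expect (fun A => (j <= c A)%:R * (w u * p * g j)) +
    p * \sum_(j < n) expect (fun A => w u * (1 - g (if (j <= c A)%N then (c A).+1 else c A))))).
  rewrite -!bernoulli_sum -bernoulliZ -bernoulliD.
  apply: ler_bernoulli => [e|A _]; first exact: prob_bounds.
  rewrite (sum_prefix (fun j => w u * p * g j) (cn A)) -!mulr_sumr.
  rewrite (eq_bigr (fun j : 'I_n => 1 - (if (j <= c A)%N then g (c A).+1 else g (c A)))).
    rewrite sum_insertions // mulrA [p * w u]mulrC -mulrDr ler_wpM2l //.
    have := gP _ (cn A); lra.
  by move=> j _; case: ifP.
apply: lerD; first by apply: ler_sum => j _; apply: online_share_insert.
apply: ler_wpM2l => //; apply: ler_sum => j _.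
apply: ler_bernoulli => [e|A _]; first exact: prob_bounds.
exact: offline_share_insert.
Qed.

Lemma sharing_rule_guarantee sigma : valid_strategy G sigma ->
  (1 - kappa) * strategy_value G w sigma <= greedy_value G w prio.
Proof.
move=> sigma_valid; rewrite -sum_duals; apply: weak_duality => //.
- exact: offline_dual_ge0.
- exact: online_dual_ge0.
- exact: duals_feasible.
Qed.

End Duality.

(** * Passage to the limit in the size of the sharing rule *)

Theorem theorem1p3 (R : realType) (U V : finType)
    (G : stochastic_graph R U V) (w : U -> R) (w_ge0 : forall u : U, 0 <= w u)
    (prio : V -> U -> nat) (prio_inj : forall v : V, injective (prio v)) :
  (1 - 1 / expR 1) * OPT G w <= greedy_value G w prio.
Proof.
have ratio_gt0 : 0 < 1 - 1 / expR 1 :> R.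
  by rewrite subr_gt0 ltr_pdivrMr ?expR_gt0 // mul1r expR_gt1 ltr01.
rewrite mulrC -ler_pdivlMr //; apply: ge_sup.
  by case: (strategy_values_has_sup G w_ge0).
move=> _ [sigma sigma_valid ->]; rewrite ler_pdivlMr // mulrC.
set x := strategy_value G w sigma; apply/ler_addgt0Pr => eps eps_gt0.
(* [N] is at least [#|V|], so that a rule exists, and large enough that the error [x / N.+1%:R] is
   at most [eps]. *)
pose N := maxn #|V| (Num.truncn (`|x| / eps)).
have [|g gP] := @sharing_rule_exists R #|V| N; first by rewrite leqW ?leq_maxl.
have := sharing_rule_guarantee w_ge0 prio_inj gP sigma_valid; rewrite -/x.
rewrite opprD addrA mulrDl mulNr lerBlDr => /le_trans; apply; rewrite lerD2l.
rewrite ler_pdivrMl ?ltr0n //; apply: le_trans (ler_norm x) _.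
rewrite -ler_pdivrMr //; apply: ltW; apply: lt_le_trans (truncnS_gt _) _.
by rewrite ler_nat ltnS leq_maxr.
Qed.
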